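(* Let $(M_1\times_f M_2,F)$ be a flat twisted product Finsler manifold and suppose $(M_2,F_2)$ is Riemannian. If $f$ is a function on $M_1$ only, then $(M_2,F_2)$ is a space of positive constant curvature $\|\mathrm{grad} f\|^2$.
   Context: Let $(M_1,F_1)$, $(M_2,F_2)$ be Finsler manifolds (metrics smooth on the slit tangent bundle, positively 1-homogeneous on fibres, with positive definite fundamental tensor) and $f:M_1\times M_2\to\mathbb{R}^+$ smooth. The twisted product $M_1\times_f M_2$ is $M=M_1\times M_2$ with $F=\sqrt{F_1^2(x,y)+f^2(x,u)F_2^2(u,v)}$, considered where $y\ne0$, $v\ne 0$. Local coordinates are $\mathbf{x}^a=(x^i,u^\alpha)$ with fibre coordinates $\mathbf{y}^a=(y^i,v^\alpha)$; $g_{ij}=\frac12\frac{\partial^2F_1^2}{\partial y^i\partial y^j}$, $g_{\alpha\beta}=\frac12\frac{\partial^2F_2^2}{\partial v^\alpha\partial v^\beta}$. Put $\mathbf g_{ab}=\frac12\frac{\partial^2F^2}{\partial\mathbf y^a\partial\mathbf y^b}$, $\mathbf G^a=\frac14\mathbf g^{ab}\big(\frac{\partial^2F^2}{\partial\mathbf y^b\partial\mathbf x^c}\mathbf y^c-\frac{\partial F^2}{\partial\mathbf x^b}\big)$, $\mathbf G^a_b=\frac{\partial\mathbf G^a}{\partial\mathbf y^b}$, $\frac{\delta^t}{\delta^t\mathbf x^a}=\frac{\partial}{\partial\mathbf x^a}-\mathbf G^b_a\frac{\partial}{\partial\mathbf y^b}$, and $$\mathbf F^c_{ab}=\tfrac12\mathbf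 g^{ce}\Big(\frac{\delta^t\mathbf g_{ea}}{\delta^t\mathbf x^b}+\frac{\delta^t\mathbf g_{eb}}{\delta^t\mathbf x^a}-\frac{\delta^t\mathbf g_{ab}}{\delta^t\mathbf x^e}\Big),\qquad \mathbf R^{\ a}_{b\ cd}=\frac{\delta^t\mathbf F^a_{bc}}{\delta^t\mathbf x^d}-\frac{\delta^t\mathbf F^a_{bd}}{\delta^t\mathbf x^c}+\mathbf F^a_{de}\mathbf F^e_{bc}-\mathbf F^a_{ce}\mathbf F^e_{bd}.$$ $(M_1\times_fM_2,F)$ is flat if $\mathbf R^{\ a}_{b\ cd}=0$. ''$f$ is a function on $M_1$ only'' means $\partial f/\partial u^\alpha=0$. With $f_i=\partial f/\partial x^i$, $\|\mathrm{grad} f\|^2=g^{ij}f_if_j$. A Riemannian manifold is a space of constant curvature $K$ if all its sectional curvatures equal the constant $K$.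
   Formalization: Manifolds are taken connected; positivity of ‖grad f‖² is asserted only at points where df ≠ 0 (for constant f the curvature is 0), and that ‖grad f‖² is a single constant is asserted only for dim M_2 ≥ 2 (for dim M_2 = 1 there are no sectional curvatures and it can fail). *)

(* Defs.v *)
From HB Require Import structures.
From mathcomp Require Import all_boot all_order all_algebra.
From mathcomp Require Import all_classical all_reals all_analysis.

Set Implicit Arguments.
Unset Strict Implicit.
Unset Printing Implicit Defensive.

Import Order.TTheory GRing.Theory Num.Theory.
Import numFieldNormedType.Exports.

Local Open Scope classical_set_scope.
Local Open Scope ring_scope.

Section Calculus.
Context {R : realType} {n : nat}.

Definition partial (k : 'I_n) (f : 'rV[R]_n -> R) (x : 'rV[R]_n) : R :=
  'D_(delta_mx 0 k) f x.

Definition iter_partial (s : seq 'I_n) (f : 'rV[R]_n -> R) : 'rV[R]_n -> R :=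
  foldr partial f s.

(* For U open, this is C^oo on U: every iterated partial derivative exists and is
   continuous at every point of U. *)
Definition smooth_on (U : set 'rV[R]_n) (f : 'rV[R]_n -> R) : Prop :=
  forall (s : seq 'I_n) (x : 'rV[R]_n), U x ->
    {for x, continuous (iter_partial s f)} /\
    (forall k, derivable (iter_partial s f) x (delta_mx 0 k)).

End Calculus.

(* Connected, Hausdorff, second countable smooth n-manifold, given by an atlas
   of charts indexed by [chart]; [coord i] is the homeomorphism from the open
   set [dom i] onto its open image and [param i] is its inverse (both total,
   with irrelevant values elsewhere). *)
Record smooth_manifold (R : realType) (n : nat) := SmoothManifold {
  carrier :> topologicalType ;
  chart : Type ;
  dom : chart -> set carrier ;
  coord : chart -> carrier -> 'rV[R]_n ;
  param : chart -> 'rV[R]_n -> carrier ;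
  manifold_nonempty : [set: carrier] !=set0 ;
  manifold_connected : connected [set: carrier] ;
  manifold_hausdorff : hausdorff_space carrier ;
  manifold_second_countable : @second_countable carrier ;
  dom_open : forall i, open (dom i) ;
  dom_cover : forall p, exists i, dom i p ;
  coordK : forall i p, dom i p -> param i (coord i p) = p ;
  coord_image_open : forall i, open (coord i @` dom i) ;
  coord_continuous : forall i p, dom i p -> {for p, continuous (coord i)} ;
  param_continuous : forall i x, (coord i @` dom i) x ->
    {for x, continuous (param i)} ;
  transition_smooth : forall i j (k : 'I_n),
    smooth_on [set x | (coord i @` dom i) x /\ dom j (param i x)]
              (fun x => coord j (param i x) 0 k)
}.

Arguments chart {R n}.
Arguments dom {R n} _ _ _.
Arguments coord {R n} _ _ _.
Arguments param {R n} _ _ _.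

Section Manifold.
Context {R : realType} {n : nat} (M : smooth_manifold R n).

Definition chart_image (i : chart M) : set 'rV[R]_n := coord M i @` dom M i.

Definition overlap (i j : chart M) : set 'rV[R]_n :=
  [set x | chart_image i x /\ dom M j (param M i x)].

Definition transition (i j : chart M) (x : 'rV[R]_n) : 'rV[R]_n :=
  coord M j (param M i x).

End Manifold.

(* Tensor calculus of a Finsler function L(x, y) in one coordinate system, with
   base coordinates x and fibre coordinates y. *)
Section LocalFinsler.
Context {R : realType} {n : nat}.
Implicit Types (L phi : 'rV[R]_n -> 'rV[R]_n -> R) (x y : 'rV[R]_n).

Definition dbase (a : 'I_n) phi x y : R := partial a (fun x' => phi x' y) x.

Definition dfibre (a : 'I_n) phi x y : R := partial a (phi x) y.

Definition energy L x y : R := L x y ^+ 2.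

Definition fundamental_tensor L x y : 'M[R]_n :=
  \matrix_(a, b) (2^-1 * dfibre a (dfibre b (energy L)) x y).

Definition inverse_tensor L x y : 'M[R]_n := invmx (fundamental_tensor L x y).

Definition spray L (a : 'I_n) x y : R :=
  4^-1 * \sum_b inverse_tensor L x y a b *
    (\sum_c dfibre b (dbase c (energy L)) x y * y 0 c
     - dbase b (energy L) x y).

(* [nonlinear_connection L a b] is G^a_b = dG^a / dy^b *)
Definition nonlinear_connection L (a b : 'I_n) x y : R :=
  dfibre b (spray L a) x y.

Definition delta L (a : 'I_n) phi x y : R :=
  dbase a phi x y - \sum_b nonlinear_connection L b a x y * dfibre b phi x y.

(* [hconnection L c a b] is F^c_{ab} *)
Definition hconnection L (c a b : 'I_n) x y : R :=
  2^-1 * \sum_e inverse_tensor L x y c e *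
    (delta L b (fun x' y' => fundamental_tensor L x' y' e a) x y
     + delta L a (fun x' y' => fundamental_tensor L x' y' e b) x y
     - delta L e (fun x' y' => fundamental_tensor L x' y' a b) x y).

(* [hhcurvature L b a c d] is R_b^a_{cd} *)
Definition hhcurvature L (b a c d : 'I_n) x y : R :=
  delta L d (hconnection L a b c) x y - delta L c (hconnection L a b d) x y
  + \sum_e hconnection L a d e x y * hconnection L e b c x y
  - \sum_e hconnection L a c e x y * hconnection L e b d x y.

End LocalFinsler.

(* A Finsler metric is given by its expressions F i (x, y) in the charts: y
   collects the components of a tangent vector in the coordinate frame of the
   chart i, and the expressions in two charts agree on their overlap. *)
Record finsler_metric (R : realType) (n : nat) (M : smooth_manifold R n) :=
  FinslerMetric {
  finsler_expr :> chart M -> 'rV[R]_n -> 'rV[R]_n -> R ;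
  finsler_ge0 : forall i x y, chart_image i x -> 0 <= finsler_expr i x y ;
  finsler_transition : forall i j x y, overlap i j x ->
    finsler_expr j (transition i j x) ('D_y (transition i j) x)
    = finsler_expr i x y ;
  finsler_smooth : forall i,
    smooth_on [set z : 'rV[R]_(n + n) |
                chart_image i (lsubmx z) /\ rsubmx z != 0]
              (fun z => finsler_expr i (lsubmx z) (rsubmx z)) ;
  finsler_homogeneous : forall i x y (t : R), chart_image i x -> 0 < t ->
    finsler_expr i x (t *: y) = t * finsler_expr i x y ;
  finsler_posdef : forall i x y (w : 'rV[R]_n),
    chart_image i x -> y != 0 -> w != 0 ->
    0 < (w *m fundamental_tensor (finsler_expr i) x y *m w^T) 0 0
}.

Section LocalRiemann.
Context {R : realType} {n : nat}.
Implicit Types (h : 'rV[R]_n -> 'M[R]_n) (x X Y Z : 'rV[R]_n).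

(* [christoffel h c a b] is Gamma^c_{ab} *)
Definition christoffel h (c a b : 'I_n) x : R :=
  2^-1 * \sum_e invmx (h x) c e *
    (partial a (fun x' => h x' e b) x + partial b (fun x' => h x' e a) x
     - partial e (fun x' => h x' a b) x).

(* R(d_c, d_d) d_b = \sum_a riemann h a b c d d_a *)
Definition riemann h (a b c d : 'I_n) x : R :=
  partial c (christoffel h a d b) x - partial d (christoffel h a c b) x
  + \sum_e christoffel h a c e x * christoffel h e d b x
  - \sum_e christoffel h a d e x * christoffel h e c b x.

Definition metric_pairing h x X Y : R := (X *m h x *m Y^T) 0 0.

Definition riemann_op h x X Y Z : 'rV[R]_n :=
  \row_a \sum_b \sum_c \sum_d riemann h a b c d x * X 0 c * Y 0 d * Z 0 b.

Definition sectional_curvature h x X Y : R :=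
  metric_pairing h x (riemann_op h x X Y Y) X /
  (metric_pairing h x X X * metric_pairing h x Y Y
   - metric_pairing h x X Y ^+ 2).

End LocalRiemann.

Section Riemannian.
Context {R : realType} {n : nat} {M : smooth_manifold R n}.

(* F is Riemannian, and h is its metric tensor in the charts *)
Definition is_riemannian (F : finsler_metric M)
    (h : chart M -> 'rV[R]_n -> 'M[R]_n) : Prop :=
  forall i x, chart_image i x ->
    (h i x)^T = h i x /\
    (forall y, F i x y ^+ 2 = (y *m h i x *m y^T) 0 0).

Definition constant_curvature (h : chart M -> 'rV[R]_n -> 'M[R]_n) (K : R) :
    Prop :=
  forall i x (X Y : 'rV[R]_n), chart_image i x -> row_free (col_mx X Y) ->
    sectional_curvature (h i) x X Y = K.

End Riemannian.

Section TwistedProduct.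
Context {R : realType} {n1 n2 : nat}.
Context {M1 : smooth_manifold R n1} {M2 : smooth_manifold R n2}.
Variables (F1 : finsler_metric M1) (F2 : finsler_metric M2).
Variable f : M1 * M2 -> R.

Definition fun_expr (i : chart M1) (j : chart M2) (x : 'rV[R]_n1)
    (u : 'rV[R]_n2) : R :=
  f (param M1 i x, param M2 j u).

Definition smooth_on_product : Prop :=
  forall i j,
    smooth_on [set z : 'rV[R]_(n1 + n2) |
                chart_image i (lsubmx z) /\ chart_image j (rsubmx z)]
              (fun z => fun_expr i j (lsubmx z) (rsubmx z)).

Definition twisted_metric (i : chart M1) (j : chart M2)
    (x y : 'rV[R]_(n1 + n2)) : R :=
  Num.sqrt (F1 i (lsubmx x) (lsubmx y) ^+ 2
            + fun_expr i j (lsubmx x) (rsubmx x) ^+ 2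
              * F2 j (rsubmx x) (rsubmx y) ^+ 2).

Definition twisted_flat : Prop :=
  forall i j (x y : 'rV[R]_(n1 + n2)) (a b c d : 'I_(n1 + n2)),
    chart_image i (lsubmx x) -> chart_image j (rsubmx x) ->
    lsubmx y != 0 -> rsubmx y != 0 ->
    hhcurvature (twisted_metric i j) b a c d x y = 0.

Definition function_on_first_factor : Prop :=
  forall i j x u (k : 'I_n2), chart_image i x -> chart_image j u ->
    partial k (fun_expr i j x) u = 0.

Definition differential1 (i : chart M1) (j : chart M2) (x : 'rV[R]_n1)
    (u : 'rV[R]_n2) : 'rV[R]_n1 :=
  \row_k partial k (fun x' => fun_expr i j x' u) x.

Definition grad_norm2 (i : chart M1) (j : chart M2) (x y : 'rV[R]_n1)
    (u : 'rV[R]_n2) : R :=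
  \sum_k \sum_l inverse_tensor (F1 i) x y k l
    * differential1 i j x u 0 k * differential1 i j x u 0 l.

End TwistedProduct.

(* Main.v *)
(** In product coordinates the fundamental tensor of the twisted product is the
    block matrix diag(g1(x, y), f^2(x) h(u)).  Its second block does not depend
    on the fibre coordinates, so the horizontal derivatives of that block are
    plain partial derivatives and the spray drops out.  Hence, with a, b, c, d
    indices of the second factor and k, l indices of the first,
      F^a_bc = Gamma^a_bc (Christoffel symbols of h),
      F^a_bk = (f_k / f) delta^a_b,   F^k_bc = - f g1^kl f_l h_bc,
    and the component R_b^a_cd of the curvature is
      (d_d Gamma^a_bc - d_c Gamma^a_bd + Gamma^a_de Gamma^e_bc - Gamma^a_ce Gamma^e_bd)
        - |grad f|^2 (delta^a_d h_bc - delta^a_c h_bd).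
    Flatness therefore makes h a metric of constant curvature |grad f|^2.  That
    this number is the same in every chart of the second factor rests on the
    connectedness of M2: a function with vanishing u-derivatives is constant
    in u. *)

Require Import Defs.
From HB Require Import structures.
From mathcomp Require Import all_boot all_order all_algebra.
From mathcomp Require Import ring.
From mathcomp Require Import all_classical all_reals all_analysis.

Import Order.TTheory GRing.Theory Num.Theory.
Import numFieldNormedType.Exports.

Local Open Scope classical_set_scope.
Local Open Scope ring_scope.

(** * Derivatives determined by increments along a line *)

Section DifferenceQuotient.
Context {R : realType} {V1 V2 W : normedModType R}.
Variables (f : V1 -> W) (g : V2 -> W) (a v : V1) (b w : V2).

Hypothesis eq_increment :
  \forall t \near (0 : R), f (t *: v + a) - f a = g (t *: w + b) - g b.

Let eq_quotient :
  (fun t : R => t^-1 *: ((f \o shift a) (t *: v) - f a)) @ 0^' =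
  (fun t : R => t^-1 *: ((g \o shift b) (t *: w) - g b)) @ 0^'.
Proof.
have eqt : \forall t \near (0 : R)^',
  t^-1 *: ((f \o shift a) (t *: v) - f a) = t^-1 *: ((g \o shift b) (t *: w) - g b).
  apply: cvg_within; near=> t; rewrite /= /shift.
  by congr (_ *: _); near: t; exact: eq_increment.
rewrite eqEsubset; split; apply: near_eq_cvg => //.
by apply: filterS eqt.
Unshelve. all: by end_near. Qed.

(** A directional derivative sees only the increments along its line near the base point, so it
    passes between spaces of different dimension. Differentiability is not assumed: the two filters
    of difference quotients coincide. *)
Lemma derive_eq_increment : 'D_v f a = 'D_w g b.
Proof. by rewrite /derive eq_quotient. Qed.

Lemma derivable_eq_increment : derivable f a v = derivable g b w.
Proof. by rewrite /derivable eq_quotient. Qed.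

End DifferenceQuotient.

Section DirectionalDerivative.
Context {R : realType} {V : normedModType R}.
Implicit Types (a v : V) (U : set V).

Lemma near_line U a v : open U -> U a -> \forall t \near (0 : R), U (t *: v + a).
Proof.
move=> oU Ua.
have : ((fun t : R => t *: v + a) @ (0 : R)) --> (0 : R) *: v + a.
  apply: cvgD; last exact: cvg_cst.
  by apply: cvgZr_tmp; exact: cvg_id.
by rewrite scale0r add0r; apply; exact: open_nbhs_nbhs.
Qed.

Lemma derive_near_cst (f : V -> R) a v :
  (\forall t \near (0 : R), f (t *: v + a) = f a) -> 'D_v f a = 0.
Proof.
move=> fa; rewrite -(derive_cst (0 : R) a v); apply: derive_eq_increment.
by apply: filterS fa => t ->; rewrite !subrr.
Qed.

Lemma derive_eq_on (U : set V) (f g : V -> R) a v : open U -> U a ->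
  (forall z, U z -> f z = g z) -> 'D_v f a = 'D_v g a.
Proof.
move=> oU Ua fg; apply: near_eq_derive.
by apply: filterS (open_nbhs_nbhs (conj oU Ua)).
Qed.

(** Along the line, [f] is up to a constant the polynomial [p], whose derivative at 0 is its linear
    coefficient. This gives the fibre derivatives of quadratic forms exactly. *)
Lemma derive_quadratic (f : V -> R) a v (c d : R) :
  (forall t : R, f (t *: v + a) - f a = t * c + t ^+ 2 * d) -> 'D_v f a = c.
Proof.
move=> ft; pose p : {poly R} := c%:P * 'X + d%:P * 'X^2.
rewrite (_ : 'D_v f a = 'D_1 (horner p) 0).
  rewrite (@derive_val _ _ _ _ _ _ _ (is_derive_poly p 0)) /p.
  rewrite !(derivD, derivM, derivC, derivX, derivXn) !hornerE /=.
  by rewrite mulr0 mul0r !addr0.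
apply: derive_eq_increment; near=> t; rewrite ft scaler1.
by rewrite !hornerE /=; ring.
Unshelve. all: by end_near. Qed.

End DirectionalDerivative.

(** * Positive definite matrices and their inverses *)

Section PositiveDefinite.
Context {R : realType} {n : nat} (A : 'M[R]_n).
Hypothesis A_posdef : forall w : 'rV[R]_n, w != 0 -> 0 < (w *m A *m w^T) 0 0.

Lemma posdef_unitmx : A \in unitmx.
Proof.
rewrite unitmxE unitfE; apply/det0P => -[v v0 vA].
by have := A_posdef v v0; rewrite vA mul0mx mxE ltxx.
Qed.

(** Substitute w = z A: the value is the 1 x 1 matrix z w^T, which equals its transpose w z^T = z A
    z^T. *)
Lemma posdef_invmx (w : 'rV[R]_n) : w != 0 -> 0 < (w *m invmx A *m w^T) 0 0.
Proof.
move=> w0; set z := w *m invmx A.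
have wE : w = z *m A by rewrite mulmxKV // posdef_unitmx.
have z0 : z != 0 by apply: contraNneq w0 => z0; rewrite wE z0 mul0mx.
rewrite (_ : _ 0 0 = (z *m A *m z^T) 0 0); first exact: A_posdef.
by rewrite -wE -[z *m w^T]trmxK trmx_mul trmxK [LHS]mxE.
Qed.

End PositiveDefinite.

(** * Gram determinants and sectional curvature at a point *)

Section MetricPairing.
Context {R : realType} {n : nat} (h : 'rV[R]_n -> 'M[R]_n) (x : 'rV[R]_n).
Local Notation q := (metric_pairing h x).

Lemma metric_pairingE X Y :
  q X Y = \sum_a \sum_b X 0 a * h x a b * Y 0 b.
Proof.
rewrite /metric_pairing mxE exchange_big; apply: eq_bigr => b _ /=.
by rewrite !mxE mulr_suml.
Qed.

Lemma metric_pairingDl X X' Y : (q (X + X') (Y)) = q X Y + (q (X') (Y)).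
Proof. by rewrite /metric_pairing !mulmxDl mxE. Qed.

Lemma metric_pairingZl t X Y : (q (t *: X) (Y)) = t * q X Y.
Proof. by rewrite /metric_pairing -!scalemxAl mxE. Qed.

Hypothesis h_sym : (h x)^T = h x.

Lemma metric_pairingC X Y : q X Y = q Y X.
Proof.
rewrite /metric_pairing -[in LHS](trmxK (X *m h x *m Y^T)) [LHS]mxE.
by rewrite !trmx_mul trmxK h_sym mulmxA.
Qed.

Lemma metric_pairingDr X Y Y' : (q (X) (Y + Y')) = q X Y + (q (X) (Y')).
Proof. by rewrite ![metric_pairing h x X _]metric_pairingC metric_pairingDl. Qed.

Lemma metric_pairingZr t X Y : (q (X) (t *: Y)) = t * q X Y.
Proof. by rewrite ![metric_pairing h x X _]metric_pairingC metric_pairingZl. Qed.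

Hypothesis h_posdef : forall w, w != 0 -> 0 < q w w.

Lemma metric_gram_gt0 X Y : row_free (col_mx X Y) ->
  0 < q X X * q Y Y - q X Y ^+ 2.
Proof.
move=> freeXY.
have indep s t : s *: X + t *: Y = 0 -> s = 0 /\ t = 0.
  move=> st0; have : row_mx (s%:M : 'M[R]_1) (t%:M : 'M[R]_1) *m col_mx X Y = 0.
    by rewrite mul_row_col !mul_scalar_mx.
  move/eqP; rewrite mulmx_free_eq0 // => /eqP st.
  have := st; rewrite -[0]row_mx0 => /eq_row_mx[/matrixP/(_ 0 0) + /matrixP/(_ 0 0)].
  by rewrite !mxE !eqxx !mulr1n.
have Y0 : Y != 0.
  apply/eqP => Y0; have [] : 0 = 0 :> R /\ 1 = 0 :> R.
    by apply: indep; rewrite Y0 scale0r scaler0 addr0.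
  by move=> _ /eqP; rewrite oner_eq0.
have YY := h_posdef Y Y0.
(* This is [q Y Y] times the component of [X] orthogonal to [Y]. Its square norm is [q Y Y] times
   the Gram determinant, and it is nonzero since the coefficient of [X] is positive. *)
pose w := q Y Y *: X + (- q X Y) *: Y.
have w0 : w != 0.
  by apply/eqP => /indep[/eqP]; rewrite gt_eqF.
have := h_posdef w w0.
rewrite /w metric_pairingDl !metric_pairingZl !metric_pairingDr !metric_pairingZr.
rewrite (metric_pairingC Y X) => ww.
move: ww; rewrite [X in 0 < X](_ : _ = q Y Y * (q X X * q Y Y - q X Y ^+ 2)).
  by rewrite pmulr_rgt0.
by ring.
Qed.

(** Contracting the tensor gives R(X,Y)Y = K (q(Y,Y) X - q(X,Y) Y). Its pairing with [X] is [K]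
    times the Gram determinant, which is nonzero for independent vectors. *)
Lemma sectional_curvature_const (K : R) X Y :
  (forall a b c d : 'I_n, riemann h a b c d x =
     K * ((a == c)%:R * h x b d - (a == d)%:R * h x b c)) ->
  row_free (col_mx X Y) -> sectional_curvature h x X Y = K.
Proof.
move=> riemE freeXY; rewrite /sectional_curvature.
have -> : riemann_op h x X Y Y = (K * q Y Y) *: X - (K * q X Y) *: Y.
  apply/rowP => a; rewrite !mxE.
  transitivity (\sum_b (K * X 0 a * (\sum_d Y 0 b * h x b d * Y 0 d)
                      - K * Y 0 a * (\sum_c Y 0 b * h x b c * X 0 c))).
    apply: eq_bigr => b _; rewrite !mulr_sumr.
    transitivity (\sum_c \sum_d (K * (a == c)%:R * (X 0 c * h x b d * Y 0 d * Y 0 b))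
                  - \sum_c \sum_d (K * (a == d)%:R * (X 0 c * h x b c * Y 0 d * Y 0 b))).
      rewrite -sumrB; apply: eq_bigr => c _; rewrite -sumrB; apply: eq_bigr => d _.
      by rewrite riemE; ring.
    congr (_ - _).
      rewrite (bigD1 a) //= [X in _ + X]big1 ?addr0.
        by apply: eq_bigr => d _; rewrite eqxx mulr1n; ring.
      move=> c /negbTE; rewrite eq_sym => ->; rewrite big1 // => d _.
      by rewrite mulr0n; ring.
    rewrite exchange_big (bigD1 a) //= [X in _ + X]big1 ?addr0.
      by apply: eq_bigr => d _; rewrite eqxx mulr1n; ring.
    move=> c /negbTE; rewrite eq_sym => ->; rewrite big1 // => d _.
    by rewrite mulr0n; ring.
  rewrite (metric_pairingC X Y) !metric_pairingE sumrB -!mulr_sumr; ring.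
rewrite -scaleNr metric_pairingDl !metric_pairingZl (metric_pairingC Y X).
have gram0 := lt0r_neq0 (metric_gram_gt0 X Y freeXY).
by apply: (mulIf gram0); rewrite divfK //; ring.
Qed.

End MetricPairing.

Lemma quadratic_form_increment (R : realType) n (A : 'M[R]_n) (v : 'rV[R]_n) b t :
  A^T = A ->
  let w := t *: delta_mx 0 b + v in
  (w *m A *m w^T) 0 0 - (v *m A *m v^T) 0 0 =
  t * (2 * (v *m A) 0 b) + t ^+ 2 * A b b.
Proof.
move=> symA w; pose q := metric_pairing (fun _ : 'rV[R]_n => A) 0.
pose e : 'rV[R]_n := delta_mx 0 b.
have qC X Y : q X Y = q Y X by exact: metric_pairingC.
have qve X : q X e = (X *m A) 0 b by rewrite /q /metric_pairing trmx_delta -colE mxE.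
change (q w w - q v v = t * (2 * (v *m A) 0 b) + t ^+ 2 * A b b).
rewrite /w -/e /q metric_pairingDl metric_pairingZl.
rewrite !metric_pairingDr // !metric_pairingZr // -/q (qC e v) !qve.
have -> : (e *m A) 0 b = A b b by rewrite -rowE mxE.
by ring.
Qed.

Lemma linear_form_increment (R : realType) n (A : 'M[R]_n) (v : 'rV[R]_n) a b t :
  ((t *: delta_mx 0 a + v) *m A) 0 b - (v *m A) 0 b = t * A a b.
Proof.
by rewrite mulmxDl -scalemxAl -rowE !mxE addrK.
Qed.

(** * Coordinate directions in a product, and horizontal derivatives of base functions *)

Section BlockCoordinates.
Context {R : realType} {n1 n2 : nat}.
Implicit Types (z : 'rV[R]_(n1 + n2)) (t : R).

Lemma lsubmx_delta_lshift t k z :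
  lsubmx (t *: delta_mx 0 (lshift n2 k) + z) = t *: delta_mx 0 k + lsubmx z.
Proof. by apply/rowP => l; rewrite !mxE (inj_eq (@lshift_inj _ _)). Qed.

Lemma rsubmx_delta_lshift t k z :
  rsubmx (t *: delta_mx 0 (lshift n2 k) + z) = rsubmx z.
Proof. by apply/rowP => l; rewrite !mxE eq_rlshift andbF mulr0 add0r. Qed.

Lemma lsubmx_delta_rshift t k z :
  lsubmx (t *: delta_mx 0 (rshift n1 k) + z) = lsubmx z.
Proof. by apply/rowP => l; rewrite !mxE eq_lrshift andbF mulr0 add0r. Qed.

Lemma rsubmx_delta_rshift t k z :
  rsubmx (t *: delta_mx 0 (rshift n1 k) + z) = t *: delta_mx 0 k + rsubmx z.
Proof. by apply/rowP => l; rewrite !mxE (inj_eq (@rshift_inj _ _)). Qed.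

End BlockCoordinates.

(** Every fibre derivative of [phi] vanishes at (x, y), so the nonlinear connection never has to be
    computed. The open sets [U] and [V] leave room for formulas valid only over a chart and away
    from some fibre vectors. *)
Lemma delta_base_function {R : realType} {n : nat}
    (L phi : 'rV[R]_n -> 'rV[R]_n -> R) (psi : 'rV[R]_n -> R)
    (U V : set 'rV[R]_n) a x y : open U -> U x -> open V -> V y ->
  (forall x' y', U x' -> V y' -> phi x' y' = psi x') ->
  delta L a phi x y = partial a psi x.
Proof.
move=> oU Ux oV Vy phiE; rewrite /delta big1 ?subr0 => [|b _].
  by apply: (derive_eq_on U) => // z Uz; exact: phiE.
rewrite [X in _ * X]derive_near_cst ?mulr0 //.
by apply: filterS (near_line _ _ (delta_mx 0 b) oV Vy) => t Vt; rewrite !phiE.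
Qed.

(** * Metric tensor and Christoffel symbols of a Riemannian factor *)

Section RiemannianFactor.
Context {R : realType} {n : nat} {M : smooth_manifold R n}.
Context (F : finsler_metric M) (h : chart M -> 'rV[R]_n -> 'M[R]_n).
Hypothesis riemF : is_riemannian F h.
Context (j : chart M) (u : 'rV[R]_n) (ju : chart_image j u).

Lemma riemannian_sym : (h j u)^T = h j u.
Proof. by have [] := riemF j u ju. Qed.

(** The energy is a quadratic form in the fibre, so two exact derivatives recover its matrix, also
    at [v = 0]. *)
Lemma fundamental_tensor_riemannian v : fundamental_tensor (F j) u v = h j u.
Proof.
have [symh FE] := riemF j u ju.
apply/matrixP => a b; rewrite mxE.
have dE w : dfibre b (energy (F j)) u w = 2 * (w *m h j u) 0 b.
  apply: (derive_quadratic _ _ _ _ (h j u b b)) => t.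
  by rewrite /energy !FE quadratic_form_increment.
rewrite (_ : dfibre a _ u v = 2 * h j u a b) ?mulKf ?pnatr_eq0 //.
apply: (derive_quadratic _ _ _ _ 0) => t.
by rewrite !dE -mulrBr linear_form_increment; ring.
Qed.

Lemma riemannian_posdef (w : 'rV[R]_n) : w != 0 -> 0 < (w *m h j u *m w^T) 0 0.
Proof.
by move=> w0; rewrite -(fundamental_tensor_riemannian w); exact: finsler_posdef.
Qed.

(** [is_riemannian] states no regularity of [h]; it comes from that of [F] by polarization, h_ab =
    (F^2(e_a + e_b) - F^2(e_a) - F^2(e_b)) / 2. *)
Lemma riemannian_derivable a b (k : 'I_n) :
  derivable (fun u' => h j u' a b) u (delta_mx 0 k).
Proof.
pose e c : 'rV[R]_n := delta_mx 0 c.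
have dF y : y != 0 -> derivable (fun u' => F j u' y ^+ 2) u (delta_mx 0 k).
  move=> y0; rewrite (_ : (fun u' => _) = (fun u' => F j u' y) ^+ 2); last exact/funext.
  apply: derivableX.
  have [|_ /(_ (lshift n k)) dz] := @finsler_smooth _ _ _ F j [::] (row_mx u y).
    by rewrite /= row_mxKl row_mxKr.
  rewrite (derivable_eq_increment _ (fun z => F j (lsubmx z) (rsubmx z)) _ _
    (row_mx u y) (delta_mx 0 (lshift n k))) //.
  near=> t; rewrite lsubmx_delta_lshift rsubmx_delta_lshift.
  by rewrite row_mxKl row_mxKr.
have e0 c : e c != 0.
  by apply/eqP => /rowP/(_ c)/eqP; rewrite !mxE !eqxx oner_eq0.
(* [F] is smooth only off the zero section, so this vector has to be nonzero as well; its entry at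
   [a] is 1, or 2 when [a = b]. *)
have ee0 : e a + e b != 0.
  apply/eqP => /rowP/(_ a)/eqP; rewrite !mxE !eqxx /= -natrD pnatr_eq0.
  by rewrite addn_eq0.
pose hab u' := 2^-1 * (F j u' (e a + e b) ^+ 2 - F j u' (e a) ^+ 2 - F j u' (e b) ^+ 2).
have : derivable hab u (delta_mx 0 k).
  apply: derivableM; first exact: derivable_cst.
  by apply: derivableB; [apply: derivableB|]; exact: dF.
apply: near_eq_derivable.
have nju : \forall z \near u, chart_image j z.
  by apply: open_nbhs_nbhs; split => //; exact: coord_image_open.
apply: filterS nju => z jz; have [symz FE] := riemF j z jz.
rewrite /hab !FE.
change (2^-1 * (metric_pairing (h j) z (e a + e b) (e a + e b)
  - metric_pairing (h j) z (e a) (e a) - metric_pairing (h j) z (e b) (e b)) = h j z a b).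
rewrite metric_pairingDl !metric_pairingDr // (metric_pairingC _ _ _ (e b) (e a)) //.
have -> : metric_pairing (h j) z (e a) (e b) = h j z a b.
  by rewrite /metric_pairing trmx_delta -colE mxE -rowE mxE.
by field.
Unshelve. all: by end_near. Qed.

Lemma christoffel_sym c a b : christoffel (h j) c a b u = christoffel (h j) c b a u.
Proof.
congr (_ * _); apply: eq_bigr => e _; congr (_ * _).
rewrite [X in X - _]addrC; congr (_ - _).
apply: (derive_eq_on (chart_image j)) => // [|z jz]; first exact: coord_image_open.
by have [symz _] := riemF j z jz; rewrite -{1}symz mxE.
Qed.

End RiemannianFactor.

(** * Fundamental tensor of the twisted product in product coordinates *)

Section TwistedProductWithRiemannianFactor.
Context {R : realType} {n1 n2 : nat}.
Context {M1 : smooth_manifold R n1} {M2 : smooth_manifold R n2}.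
Context (F1 : finsler_metric M1) (F2 : finsler_metric M2) (f : M1 * M2 -> R).
Context (h : chart M2 -> 'rV[R]_n2 -> 'M[R]_n2).
Hypothesis f_gt0 : forall p, 0 < f p.
Hypothesis f_smooth : smooth_on_product f.
Hypothesis f_first : forall p q q', f (p, q) = f (p, q').
Hypothesis riemF2 : is_riemannian F2 h.
Context (i : chart M1) (j : chart M2).

Local Notation L := (twisted_metric F1 F2 f i j).
Local Notation fe x := (fun_expr f i j (lsubmx x) (rsubmx x)).
Local Notation g1 := (fundamental_tensor (F1 i)).

Let D : set 'rV[R]_(n1 + n2) :=
  [set x | chart_image i (lsubmx x) /\ chart_image j (rsubmx x)].

Lemma open_twisted_domain : open D.
Proof.
apply: openI; apply: open_comp; try exact: coord_image_open.
- by move=> ? _; exact: continuous_lsubmx.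
- by move=> ? _; exact: continuous_rsubmx.
Qed.

Lemma open_lsubmx_neq0 : open [set y : 'rV[R]_(n1 + n2) | lsubmx y != 0].
Proof.
apply: (@open_comp _ _ (@lsubmx R 1 n1 n2) [set y | y != 0]).
  by move=> ? _; exact: continuous_lsubmx.
rewrite (_ : [set y | y != 0] = ~` [set 0]).
  by rewrite openC; apply: accessible_closed_set1; apply: hausdorff_accessible;
     exact: norm_hausdorff.
by apply/seteqP; split => y /=; [move/eqP | move=> ?; apply/eqP].
Qed.

Lemma energy_twisted x y : D x -> energy L x y =
  F1 i (lsubmx x) (lsubmx y) ^+ 2
  + fe x ^+ 2 * (rsubmx y *m h j (rsubmx x) *m (rsubmx y)^T) 0 0.
Proof.
move=> [ix jx]; rewrite /energy /twisted_metric sqr_sqrtr.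
  by have [_ ->] := riemF2 j (rsubmx x) jx.
by apply: addr_ge0; rewrite ?sqr_ge0 // mulr_ge0 ?sqr_ge0.
Qed.

Lemma dfibre_twistedl b x y : D x -> dfibre (lshift n2 b) (energy L) x y =
  dfibre b (energy (F1 i)) (lsubmx x) (lsubmx y).
Proof.
move=> Dx; apply: derive_eq_increment; near=> t.
rewrite !energy_twisted // lsubmx_delta_lshift rsubmx_delta_lshift /energy; ring.
Unshelve. all: by end_near. Qed.

Lemma dfibre_twistedr b x y : D x -> dfibre (rshift n1 b) (energy L) x y =
  fe x ^+ 2 * (2 * (rsubmx y *m h j (rsubmx x)) 0 b).
Proof.
move=> Dx; have [_ jx] := Dx.
apply: (derive_quadratic _ _ _ _ (fe x ^+ 2 * h j (rsubmx x) b b)) => t.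
rewrite !energy_twisted // lsubmx_delta_rshift rsubmx_delta_rshift.
have := quadratic_form_increment _ _ _ (rsubmx y) b t (riemannian_sym _ _ riemF2 _ _ jx).
move=> /= /eqP; rewrite subr_eq => /eqP ->; ring.
Qed.

Lemma fundamental_tensor_twisted x y : D x -> fundamental_tensor L x y =
  block_mx (g1 (lsubmx x) (lsubmx y)) 0 0 (fe x ^+ 2 *: h j (rsubmx x)).
Proof.
move=> Dx; apply/matrixP => a b; rewrite mxE.
case: (split_ordP a) => {}a ->; case: (split_ordP b) => {}b ->.
- rewrite block_mxEul mxE; congr (_ * _); apply: derive_eq_increment; near=> t.
  by rewrite !dfibre_twistedl // lsubmx_delta_lshift.
- rewrite block_mxEur mxE [X in _ * X]derive_near_cst ?mulr0 //; near=> t.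
  by rewrite !dfibre_twistedr // rsubmx_delta_lshift.
- rewrite block_mxEdl mxE [X in _ * X]derive_near_cst ?mulr0 //; near=> t.
  by rewrite !dfibre_twistedl // lsubmx_delta_rshift.
- rewrite block_mxEdr mxE (_ : dfibre _ _ _ _ = 2 * (fe x ^+ 2 * h j (rsubmx x) a b)).
    by rewrite mulKf ?pnatr_eq0.
  apply: (derive_quadratic _ _ _ _ 0) => t.
  rewrite !dfibre_twistedr // rsubmx_delta_rshift -mulrBr -mulrBr.
  by rewrite linear_form_increment; ring.
Unshelve. all: by end_near. Qed.

Lemma fun_expr_neq0 x : fe x != 0.
Proof. by rewrite gt_eqF // /fun_expr. Qed.

Lemma fun_expr_first x u u' : fun_expr f i j x u = fun_expr f i j x u'.
Proof. exact: f_first. Qed.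

(** Both diagonal blocks are invertible, being a positive definite matrix and a nonzero multiple of
    one. For the first block this is known off the zero section, hence the condition on
    [lsubmx y]. *)
Lemma inverse_tensor_twisted x y : D x -> lsubmx y != 0 -> inverse_tensor L x y =
  block_mx (inverse_tensor (F1 i) (lsubmx x) (lsubmx y)) 0
           0 (fe x ^- 2 *: invmx (h j (rsubmx x))).
Proof.
move=> Dx y0; have [ix jx] := Dx.
have g1u : g1 (lsubmx x) (lsubmx y) \in unitmx.
  by apply: posdef_unitmx => w w0; exact: finsler_posdef.
have hu : fe x ^+ 2 *: h j (rsubmx x) \in unitmx.
  rewrite unitmxZ ?unitfE ?expf_neq0 ?fun_expr_neq0 //.
  by apply: posdef_unitmx => w w0; exact: (riemannian_posdef _ _ riemF2).
rewrite /inverse_tensor fundamental_tensor_twisted // invmx_block_diag.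
  by rewrite invmxZ.
by rewrite unitmxE det_ublock unitrM -!unitmxE g1u.
Qed.

(** * Horizontal derivatives of the blocks of the fundamental tensor *)

Local Notation g a b := (fun x y => fundamental_tensor L x y a b).

Lemma delta_twisted_base phi psi (V : set 'rV[R]_(n1 + n2)) c x y :
  D x -> open V -> V y -> (forall x' y', D x' -> V y' -> phi x' y' = psi x') ->
  delta L c phi x y = partial c psi x.
Proof. by move=> Dx; apply: delta_base_function Dx; exact: open_twisted_domain. Qed.

Lemma delta_twisted_lr c a b x y : D x ->
  delta L c (g (lshift n2 a) (rshift n1 b)) x y = 0.
Proof.
move=> Dx; rewrite -[RHS](derive_cst (0 : R) x (delta_mx 0 c)).
apply: (delta_twisted_base _ _ setT) Dx _ _ _ => //; first exact: openT.
by move=> x' y' Dx' _; rewrite fundamental_tensor_twisted // block_mxEur mxE.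
Qed.

Lemma delta_twisted_rl c a b x y : D x ->
  delta L c (g (rshift n1 a) (lshift n2 b)) x y = 0.
Proof.
move=> Dx; rewrite -[RHS](derive_cst (0 : R) x (delta_mx 0 c)).
apply: (delta_twisted_base _ _ setT) Dx _ _ _ => //; first exact: openT.
by move=> x' y' Dx' _; rewrite fundamental_tensor_twisted // block_mxEdl mxE.
Qed.

Lemma delta_twisted_rr c a b x y : D x ->
  delta L c (g (rshift n1 a) (rshift n1 b)) x y =
  partial c (fun z => fe z ^+ 2 * h j (rsubmx z) a b) x.
Proof.
move=> Dx; apply: (delta_twisted_base _ _ setT) Dx _ _ _ => //; first exact: openT.
by move=> x' y' Dx' _; rewrite fundamental_tensor_twisted // block_mxEdr mxE.
Qed.

Lemma delta_twisted_r_rr c a b x y : D x ->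
  delta L (rshift n1 c) (g (rshift n1 a) (rshift n1 b)) x y =
  fe x ^+ 2 * partial c (fun u => h j u a b) (rsubmx x).
Proof.
move=> Dx; have [_ jx] := Dx; rewrite delta_twisted_rr //.
transitivity (partial c (fun u => fe x ^+ 2 * h j u a b) (rsubmx x)).
  apply: derive_eq_increment; near=> t.
  rewrite lsubmx_delta_rshift rsubmx_delta_rshift.
  by rewrite (fun_expr_first _ _ (rsubmx x)).
by rewrite /partial deriveMl //; exact: (riemannian_derivable _ _ riemF2).
Unshelve. all: by end_near. Qed.

Lemma delta_twisted_l_rr c a b x y : D x ->
  delta L (lshift n2 c) (g (rshift n1 a) (rshift n1 b)) x y =
  2 * fe x * differential1 f i j (lsubmx x) (rsubmx x) 0 c * h j (rsubmx x) a b.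
Proof.
move=> Dx; rewrite delta_twisted_rr // mxE; set v := rsubmx x.
pose phi x' := fun_expr f i j x' v.
have dphi : derivable phi (lsubmx x) (delta_mx 0 c).
  have [|_ /(_ (lshift n2 c)) dx] := f_smooth i j [::] x; first by [].
  rewrite (derivable_eq_increment _ (fun z => fe z) _ _ x (delta_mx 0 (lshift n2 c))) //.
  by near=> t; rewrite lsubmx_delta_lshift rsubmx_delta_lshift.
transitivity ('D_(delta_mx 0 c) (h j v a b \*o (phi ^+ 2)) (lsubmx x)).
  apply: derive_eq_increment; near=> t.
  by rewrite lsubmx_delta_lshift rsubmx_delta_lshift /= !(mulrC (h j v a b)).
rewrite deriveMl; last exact: derivableX.
rewrite deriveX // expr1; set d := 'D_ _ phi _.
change (h j v a b * (2 * phi (lsubmx x) * d) = 2 * phi (lsubmx x) * d * h j v a b).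
by ring.
Unshelve. all: by end_near. Qed.

(** * Horizontal connection coefficients *)

Lemma hconnection_twisted_rrr a b c x y : D x -> lsubmx y != 0 ->
  hconnection L (rshift n1 a) (rshift n1 b) (rshift n1 c) x y =
  christoffel (h j) a b c (rsubmx x).
Proof.
move=> Dx y0; congr (_ * _); rewrite inverse_tensor_twisted // big_split_ord /=.
rewrite big1 ?add0r => [|e _]; last by rewrite block_mxEdl mxE mul0r.
apply: eq_bigr => e _; rewrite block_mxEdr mxE !delta_twisted_r_rr //.
by field; exact: fun_expr_neq0.
Qed.

Lemma hconnection_twisted_rrl a b k x y : D x -> lsubmx y != 0 ->
  hconnection L (rshift n1 a) (rshift n1 b) (lshift n2 k) x y =
  (fe x)^-1 * differential1 f i j (lsubmx x) (rsubmx x) 0 k * (a == b)%:R.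
Proof.
move=> Dx y0; have [_ jx] := Dx; rewrite /hconnection inverse_tensor_twisted //.
rewrite big_split_ord /= big1 ?add0r => [|e _]; last by rewrite block_mxEdl mxE mul0r.
have hu : h j (rsubmx x) \in unitmx.
  by apply: posdef_unitmx => w w0; exact: (riemannian_posdef _ _ riemF2).
(* Writing the Kronecker symbol as an entry of h^-1 h makes the two sides agree term by term. *)
have -> : (a == b)%:R = \sum_e invmx (h j (rsubmx x)) a e * h j (rsubmx x) e b.
  by have /matrixP/(_ a b) := mulVmx hu; rewrite !mxE => ->.
rewrite !mulr_sumr; apply: eq_bigr => e _.
rewrite block_mxEdr mxE delta_twisted_l_rr // delta_twisted_rl // delta_twisted_rl //.
by field; exact: fun_expr_neq0.
Qed.

(** The mixed blocks vanish, so only the last, negative derivative in the bracket survives; half of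
    its factor 2 f f_l gives -f f_l. *)
Lemma hconnection_twisted_lrr k b c x y : D x -> lsubmx y != 0 ->
  hconnection L (lshift n2 k) (rshift n1 b) (rshift n1 c) x y =
  - fe x * h j (rsubmx x) b c *
  \sum_l inverse_tensor (F1 i) (lsubmx x) (lsubmx y) k l
    * differential1 f i j (lsubmx x) (rsubmx x) 0 l.
Proof.
move=> Dx y0; rewrite /hconnection inverse_tensor_twisted //.
rewrite big_split_ord /= [X in _ + X]big1 ?addr0 => [|e _]; last first.
  by rewrite block_mxEur mxE mul0r.
rewrite !mulr_sumr; apply: eq_bigr => e _.
rewrite block_mxEul delta_twisted_l_rr // delta_twisted_lr // delta_twisted_lr //.
by field.
Qed.

(** The gradient norm enters here: for [e] in the first factor, the factors f_k / f and -f g1^kl f_l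
    multiply to -g1^kl f_k f_l. *)
Lemma hconnection_twisted_contract a b c d x y : D x -> lsubmx y != 0 ->
  \sum_e hconnection L (rshift n1 a) (rshift n1 d) e x y
    * hconnection L e (rshift n1 b) (rshift n1 c) x y =
  \sum_e christoffel (h j) a d e (rsubmx x) * christoffel (h j) e b c (rsubmx x)
  - (a == d)%:R * h j (rsubmx x) b c
    * grad_norm2 F1 f i j (lsubmx x) (lsubmx y) (rsubmx x).
Proof.
move=> Dx y0; rewrite big_split_ord /= addrC; congr (_ + _).
  by apply: eq_bigr => e _; rewrite !hconnection_twisted_rrr.
rewrite /grad_norm2 -mulNr mulr_sumr; apply: eq_bigr => k _.
rewrite hconnection_twisted_rrl // hconnection_twisted_lrr // !mulr_sumr.
apply: eq_bigr => l _.
by field; exact: fun_expr_neq0.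
Qed.

Lemma delta_hconnection_twisted a b c d x y : D x -> lsubmx y != 0 ->
  delta L (rshift n1 d) (hconnection L (rshift n1 a) (rshift n1 b) (rshift n1 c)) x y =
  partial d (christoffel (h j) a b c) (rsubmx x).
Proof.
move=> Dx y0.
transitivity (partial (rshift n1 d) (fun z => christoffel (h j) a b c (rsubmx z)) x).
  apply: (delta_twisted_base _ _ [set y | lsubmx y != 0]) Dx _ _ _ => //.
    exact: open_lsubmx_neq0.
  by move=> x' y' Dx' y0'; rewrite hconnection_twisted_rrr.
by apply: derive_eq_increment; near=> t; rewrite rsubmx_delta_rshift.
Unshelve. all: by end_near. Qed.

(** * Curvature of the second factor under flatness *)

Hypothesis flatF : twisted_flat F1 F2 f.

Lemma riemann_of_twisted_flat a b c d x y v :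
  chart_image i x -> y != 0 -> chart_image j v ->
  riemann (h j) a b c d v =
  grad_norm2 F1 f i j x y v * ((a == c)%:R * h j v b d - (a == d)%:R * h j v b c).
Proof.
move=> ix y0 jv.
(* Flatness is available only at fibre vectors with both components nonzero; the index [a] supplies
   a second component. *)
have w0 : delta_mx 0 a != 0 :> 'rV[R]_n2.
  by apply/eqP => /rowP/(_ a)/eqP; rewrite !mxE !eqxx oner_eq0.
pose X := row_mx x v; pose Y := row_mx y (delta_mx 0 a : 'rV[R]_n2).
have DX : D X by rewrite /D /= row_mxKl row_mxKr.
have Y0 : lsubmx Y != 0 by rewrite row_mxKl.
have christoffelC d' a' c' b' : partial d' (christoffel (h j) a' c' b') v =
    partial d' (christoffel (h j) a' b' c') v.
  apply: (derive_eq_on (chart_image j)) => //; first exact: coord_image_open.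
  by move=> u ju; exact: (christoffel_sym _ _ riemF2).
have : hhcurvature L (rshift n1 b) (rshift n1 a) (rshift n1 c) (rshift n1 d) X Y = 0.
  by apply: flatF; rewrite ?row_mxKl ?row_mxKr.
rewrite /hhcurvature !delta_hconnection_twisted // !hconnection_twisted_contract //.
rewrite row_mxKl row_mxKr row_mxKl.
(* The two curvature formulas order the lower Christoffel indices differently; symmetry reconciles
   them. *)
rewrite /riemann (christoffelC c a d b) (christoffelC d a c b).
have sumC p q : \sum_e christoffel (h j) a p e v * christoffel (h j) e q b v =
    \sum_e christoffel (h j) a p e v * christoffel (h j) e b q v.
  by apply: eq_bigr => e _; rewrite (christoffel_sym _ _ riemF2 _ _ jv e q b).
rewrite (sumC c d) (sumC d c).
move: (partial d _ v) (partial c _ v) (\sum_e _ a d e v * _) (\sum_e _ a c e v * _).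
move: (grad_norm2 _ _ _ _ _ _ _) (h j v b c) (h j v b d) (a == c)%:R (a == d)%:R.
move=> K hbc hbd ac ad pd pc Sd Sc flat0.
(* The Christoffel part of [hhcurvature] is the negative of [riemann], so subtracting the vanishing
   component from the right side leaves [riemann]. *)
by rewrite -[RHS]subr0 -flat0; ring.
Qed.

End TwistedProductWithRiemannianFactor.

(** * Vanishing partial derivatives and constancy on connected spaces *)

Section LocallyConstant.
Context {R : realType} {n : nat} (g : 'rV[R]_n -> R).

Lemma partial0_segment (u : 'rV[R]_n) k (s : R) :
  (forall t, `|t| <= `|s| -> derivable g (t *: delta_mx 0 k + u) (delta_mx 0 k) /\
    partial k g (t *: delta_mx 0 k + u) = 0) ->
  g (s *: delta_mx 0 k + u) = g u.
Proof.
move=> gs; pose G (t : R) := g (t *: delta_mx 0 k + u).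
have dG (t : R) : `|t| <= `|s| -> is_derive t (1 : R) G 0.
  move=> /gs[dg pg].
  have incr : \forall r \near (0 : R), G (r *: (1 : R) + t) - G t =
      g (r *: delta_mx 0 k + (t *: delta_mx 0 k + u)) - g (t *: delta_mx 0 k + u).
    by near=> r; rewrite /G addrA -scalerDl /GRing.scale /= mulr1.
  by apply: DeriveDef; [rewrite (derivable_eq_increment _ _ _ _ _ _ incr)
                      | rewrite (derive_eq_increment _ _ _ _ _ _ incr)].
(* The mean value theorem wants ordered endpoints; this form serves [0, s] and [s, 0] alike. *)
have Gab a b : a <= b -> (forall t, a <= t <= b -> `|t| <= `|s|) -> G b = G a.
  move=> ab sab.
  have [||c _] := MVT_segment (f := G) (df := fun=> 0) ab.
  - by move=> t /itvP tab; apply: dG; apply: sab; rewrite !tab.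
  - apply: derivable_within_continuous => t; rewrite in_itv /= => /sab/dG[dt _].
    exact: dt.
  - by rewrite mul0r => /eqP; rewrite subr_eq0 => /eqP.
suff : G s = G 0 by rewrite /G scale0r add0r.
have [s0|s0] := leP 0 s.
  by apply: Gab => // t /andP[t0 ts]; rewrite !ger0_norm.
apply/esym; apply: Gab (ltW s0) _ => t /andP[ts t0].
by rewrite (ler0_norm t0) (ltr0_norm s0) lerN2.
Unshelve. all: by end_near. Qed.

(* Two points of a sup-norm ball are joined inside it by axis-parallel segments. *)
Lemma partial0_near_cst (U : set 'rV[R]_n) u : open U -> U u ->
  (forall z k, U z -> derivable g z (delta_mx 0 k) /\ partial k g z = 0) ->
  \forall z \near u, g z = g u.
Proof.
move=> oU Uu gU.
have /nbhs_ballP[e e0 eU] : nbhs u U by apply: open_nbhs_nbhs.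
apply/nbhs_ballP; exists e => // z [_ uz].
have uzl l : `|u 0 l - z 0 l| < e by exact: uz.
(* Corners of the path from [u] to [z]: passing from [p m] to [p m.+1] changes only the coordinate
   of index [m]. *)
pose p m : 'rV[R]_n := \row_l if (l < m)%N then z 0 l else u 0 l.
have p0 : p 0%N = u by apply/rowP => l; rewrite mxE.
have pn : p n = z by apply/rowP => l; rewrite mxE ltn_ord.
suff pE m : (m <= n)%N -> g (p m) = g u by rewrite -pn; exact: pE.
elim: m => [|m IH] mn; first by rewrite p0.
rewrite -IH ?(ltnW mn) //; pose k := Ordinal mn.
have -> : p m.+1 = (z 0 k - u 0 k) *: delta_mx 0 k + p m.
  apply/rowP => l; rewrite !mxE eqxx /= ltnS leq_eqVlt.
  have [->|lk] := eqVneq l k; first by rewrite /= eqxx ltnn mulr1 subrK.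
  by rewrite -val_eqE /= in lk; rewrite (negbTE lk) mulr0 add0r.
apply: partial0_segment => t ts; apply: gU; apply: eU; split => // i l.
rewrite (ord1 i) {i} !mxE eqxx /=.
have [->|_] := eqVneq l k.
  rewrite /= ltnn mulr1 /ball /= opprD addrCA subrr addr0 normrN.
  by apply: le_lt_trans ts _; rewrite distrC.
rewrite mulr0 add0r; case: ifP => _; first exact: uzl.
by rewrite /ball /= subrr normr0.
Qed.

End LocallyConstant.

(** The preimage of any subset of [S] is open, so each level set is both open and closed. *)
Lemma connected_near_cst (T : topologicalType) (S : Type) (g : T -> S) :
  connected [set: T] -> (forall p, \forall q \near p, g q = g p) ->
  forall p q, g p = g q.
Proof.
move=> cT gnear p q.
have opn (A : set S) : open (g @^-1` A).
  by rewrite openE => r Ar; apply: filterS (gnear r) => z /= ->.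
have : [set z | g z = g q] = [set: T].
  apply: cT; first by exists q.
  - by exists (g @^-1` [set g q]) => //; rewrite setTI.
  - exists (g @^-1` [set g q]); last by rewrite setTI.
    by rewrite -openC preimage_setC.
by move=> /seteqP[_ /(_ p)]; exact.
Qed.

(** Turns the chartwise vanishing of derivatives into global independence of the second point, valid
    across charts. *)
Lemma first_factor_cst {R : realType} {n1 n2 : nat}
    {M1 : smooth_manifold R n1} {M2 : smooth_manifold R n2} (f : M1 * M2 -> R) :
  smooth_on_product f -> function_on_first_factor f ->
  forall p q q', f (p, q) = f (p, q').
Proof.
move=> fs f1 p; apply: (@connected_near_cst M2 R (fun q => f (p, q))).
  exact: manifold_connected.
move=> q; have [i ip] := dom_cover p; have [j jq] := dom_cover q.
have ipx : chart_image i (Defs.coord M1 i p) by exists p.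
have jqu : chart_image j (Defs.coord M2 j q) by exists q.
have : \forall u \near Defs.coord M2 j q,
    fun_expr f i j (Defs.coord M1 i p) u =
    fun_expr f i j (Defs.coord M1 i p) (Defs.coord M2 j q).
  apply: (partial0_near_cst _ (chart_image j)) => //; first exact: coord_image_open.
  move=> u k ju; split; last exact: f1.
  have [|_ /(_ (rshift n1 k)) dz] := fs i j [::] (row_mx (Defs.coord M1 i p) u).
    by rewrite /= row_mxKl row_mxKr.
  rewrite (derivable_eq_increment _ (fun z => fun_expr f i j (lsubmx z) (rsubmx z))
    _ _ (row_mx (Defs.coord M1 i p) u) (delta_mx 0 (rshift n1 k))) //.
  near=> t; rewrite lsubmx_delta_rshift rsubmx_delta_rshift.
  by rewrite row_mxKl row_mxKr.
move=> /(Defs.coord_continuous jq) near_u.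
have near_q : \forall q' \near q, dom M2 j q'.
  by apply: open_nbhs_nbhs; split => //; exact: dom_open.
apply: filterS2 near_q near_u => q' jq'.
by rewrite /= /fun_expr !coordK.
Unshelve. all: by end_near. Qed.

(** The gradient norm vanishes where df does, so strict positivity is claimed where df is nonzero.
    For [n2 <= 1] there are no tangent planes and [constant_curvature] is vacuous, which is why the
    common value [K] is claimed for [1 < n2]. *)
Theorem theorem4 (R : realType) (n1 n2 : nat)
    (M1 : smooth_manifold R n1) (M2 : smooth_manifold R n2)
    (F1 : finsler_metric M1) (F2 : finsler_metric M2)
    (f : M1 * M2 -> R)
    (f_gt0 : forall p, 0 < f p)
    (f_smooth : smooth_on_product f)
    (flatF : twisted_flat F1 F2 f)
    (h : chart M2 -> 'rV[R]_n2 -> 'M[R]_n2)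
    (riemF2 : is_riemannian F2 h)
    (fM1 : function_on_first_factor f) :
  (forall (i : chart M1) (j : chart M2) (x y : 'rV[R]_n1) (u : 'rV[R]_n2),
     chart_image i x -> chart_image j u -> y != 0 ->
     constant_curvature h (grad_norm2 F1 f i j x y u) /\
     (differential1 f i j x u != 0 -> 0 < grad_norm2 F1 f i j x y u)) /\
  ((1 < n2)%N -> exists K : R,
     forall (i : chart M1) (j : chart M2) (x y : 'rV[R]_n1) (u : 'rV[R]_n2),
     chart_image i x -> chart_image j u -> y != 0 ->
     grad_norm2 F1 f i j x y u = K).
Proof.
have f_first := first_factor_cst f f_smooth fM1.
have main i j x y u : chart_image i x -> chart_image j u -> y != 0 ->
    constant_curvature h (grad_norm2 F1 f i j x y u).
  move=> ix ju y0 j' u' X Y ju' freeXY.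
  (* The second factor enters the gradient norm only through [f], so the value may be moved to the
     chart and point where the curvature is taken. *)
  have -> : grad_norm2 F1 f i j x y u = grad_norm2 F1 f i j' x y u'.
    have E : differential1 f i j x u = differential1 f i j' x u'.
      apply/rowP => k; rewrite !mxE; congr (partial _ _ _); apply/funext => z.
      exact: f_first.
    by rewrite /grad_norm2 E.
  apply: sectional_curvature_const freeXY.
  - by have [] := riemF2 j' u' ju'.
  - by move=> w; exact: (riemannian_posdef _ _ riemF2).
  - by move=> a b c d;
       exact: (riemann_of_twisted_flat _ _ _ _ f_gt0 f_smooth f_first riemF2).
split.
  move=> i j x y u ix ju y0; split; first exact: main.
  move=> df0; have := posdef_invmx (fundamental_tensor (F1 i) x y) _ _ df0.
  have -> : grad_norm2 F1 f i j x y u =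
    metric_pairing (fun=> inverse_tensor (F1 i) x y) x
      (differential1 f i j x u) (differential1 f i j x u).
    rewrite metric_pairingE; apply: eq_bigr => k _; apply: eq_bigr => l _.
    by rewrite [_ * inverse_tensor _ _ _ _ _]mulrC.
  by apply=> w w0; exact: finsler_posdef.
move=> n2_gt1; have [q _] := @manifold_nonempty _ _ M2.
have [j0 jq] := dom_cover q.
pose X : 'rV[R]_n2 := delta_mx 0 (Ordinal (ltnW n2_gt1)).
pose Y : 'rV[R]_n2 := delta_mx 0 (Ordinal n2_gt1).
(* The curvature of one fixed plane at one fixed point of [M2] equals every gradient norm, whatever
   [x] and [y] are. *)
exists (sectional_curvature (h j0) (Defs.coord M2 j0 q) X Y).
move=> i j x y u ix ju y0; apply/esym; apply: (main i j x y u) => //.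
  by exists q.
rewrite -kermx_eq0; apply/rowV0P => v /sub_kermxP.
rewrite -[v]hsubmxK mul_row_col => vXY.
have v00 k : (lsubmx v *m X + rsubmx v *m Y) 0 k = 0 by rewrite vXY mxE.
have := v00 (Ordinal n2_gt1); have := v00 (Ordinal (ltnW n2_gt1)).
rewrite !mxE !big_ord1 !mxE /= !(mulr0, mulr1, add0r, addr0) => v0 v1.
apply/rowP => k; rewrite hsubmxK [RHS]mxE.
by case: (split_ordP k) => l ->; rewrite (ord1 l).
Qed.
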